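(* Let $X$ be a Banach space and let $C\in\mathcal{B}(X)$. Then $C$ is weakly compact if and only if, for every $L>1$, $C$ has the $\mathcal{G}$-FPP for the class of $L$-bi-Lipschitz affine mappings.
   Context: For a convex subset $M$ of a Banach space, $\mathcal{B}(M)$ denotes the family of all nonempty bounded, closed, convex subsets of $M$. $\mathcal{G}$-FPP (generic fixed point property): a set $C\in\mathcal{B}(X)$ has the $\mathcal{G}$-FPP for a class $\mathcal{M}$ of mappings if whenever $K\in\mathcal{B}(C)$, every $f\in\mathcal{M}$ satisfying $f(K)\subset K$ (i.e. every self-map $f\colon K\to K$ belonging to the class) has a fixed point in $K$. For $L\ge 1$, a map $f\colon K\to X$ is $L$-bi-Lipschitz if there exist constants $c_1,c_2>0$ with $c_1^{-1}c_2\le L$ such that $c_1\|x-y\|\le\|f(x)-f(y)\|\le c_2\|x-y\|$ for all $x,y\in K$. A map $f$ on a convex set $K$ is affine if $f(tx+(1-t)y)=tf(x)+(1-t)f(y)$ for all $x,y\in K$, $t\in[0,1]$. *)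

(* Defs.v *)
From HB Require Import structures.
From mathcomp Require Import all_boot all_order all_algebra.
From mathcomp Require Import all_classical all_reals all_analysis.

Set Implicit Arguments.
Unset Strict Implicit.
Unset Printing Implicit Defensive.

Import Order.TTheory GRing.Theory Num.Theory.
Import numFieldNormedType.Exports.

Local Open Scope classical_set_scope.
Local Open Scope ring_scope.

Section weak_topology.
Context {R : realType} (X : normedModType R).

Definition topological_dual : Type :=
  {phi : {linear X -> R^o} | continuous (phi : X -> R^o)}.

(* The coarsest topology on X making every continuous linear functional
   continuous; a copy of X, so that sets in X can be cast to it. *)
Definition weak_topology : Type :=
  sup_topology (fun phi : topological_dual =>
    Topological.class (initial_topology (sval phi : X -> R^o))).

HB.instance Definition _ := Topological.on weak_topology.

Definition weakly_compact (C : set X) : Prop :=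
  compact (C : set weak_topology).

End weak_topology.

Section fixed_points.
Context {R : realType} {X : normedModType R}.

(* [bcc M K] says that K belongs to the family B(M). *)
Definition bcc (M K : set X) : Prop :=
  [/\ K `<=` M, K !=set0, bounded_set K, closed K
    & convex_set (K : set (convex_lmodType X))].

(* A map K -> X is represented by a function defined on the whole of X of which
   only the restriction to K matters. Accordingly, a class of mappings is given
   by the set [Mc K] of its members with domain K, for each K. *)
Definition GFPP (C : set X) (Mc : set X -> set (X -> X)) : Prop :=
  forall (K : set X) (f : X -> X), bcc C K -> Mc K f -> f @` K `<=` K ->
    exists2 x, K x & f x = x.

Definition bilipschitz_on (L : R) (K : set X) (f : X -> X) : Prop :=
  exists c1 c2 : R, [/\ 0 < c1, 0 < c2, c1^-1 * c2 <= L &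
    forall x y, K x -> K y ->
      c1 * `|x - y| <= `|f x - f y| /\ `|f x - f y| <= c2 * `|x - y|].

Definition affine_on (K : set X) (f : X -> X) : Prop :=
  forall (x y : X) (t : R), K x -> K y -> 0 <= t <= 1 ->
    f (t *: x + (1 - t) *: y) = t *: f x + (1 - t) *: f y.

Definition bilipschitz_affine (L : R) (K : set X) : set (X -> X) :=
  [set f | bilipschitz_on L K f /\ affine_on K f].

End fixed_points.

(* Main.v *)
Require Import Defs.
From HB Require Import structures.
From mathcomp Require Import all_boot all_order all_algebra.
From mathcomp Require Import all_classical all_reals all_analysis.
From mathcomp Require Import ring lra.

(** Suppose first that C is weakly compact, and let f be an affine Lipschitz
self-map of a closed convex K inside C. Cesaro means of an orbit are almost
fixed by f, so for every e > 0 the set of the x in K with |f x - x| <= e is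
nonempty; it is also closed and convex, hence weakly closed by Hahn-Banach
separation. Weak compactness gives a point common to all these sets, and it is
fixed by f ([weakly_compact_fixed_point]).

Suppose next that C is not weakly compact. Some ultrafilter U containing C has
no weak limit. Along U every continuous linear functional phi has a limit, and
phi |-> lim phi is a point of the bidual outside X; as X is complete, that point
is at a positive distance from X ([uniform_gap]). Every finite-dimensional
subspace of X then stays at distance at least d from some convex member of U,
because bounded parts of the subspace are compact ([span_gap]). Separating the
subspace from that member, and then picking a point of C on which finitely many
functionals are close to their limits, one builds points x_n of C and functionals
phi_n of norm at most one such that phi_n vanishes on x_0, ..., x_(n-1) and is
almost equal to a constant, at least d, on the later points
([triangular_sequence]). If the errors are summable, the coefficients of a linear
combination of the x_k are controlled by its norm ([triangular_coef_bound]), and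
this yields functionals psi_n of norm at most one with psi_n (x_n) > 0 and
psi_n (x_k) = 0 for k <> n ([triangular_biorthogonal]).

Let K be the closed convex hull of the x_n. The map
  T y = y + sum_n a_n psi_n(y) (x_(n+1) - x_n),
for small positive a_n with finite sum, pushes the mass that y has at x_n a
little towards x_(n+1). It differs from the identity by a linear map of norm at
most 1/2, so it is 3-bi-Lipschitz, and it maps K to itself. If T z = z with z in
K, then applying psi_0, psi_1, ... in turn gives psi_n z = 0 for all n: no mass
of z sits at any x_n, all of it has escaped to infinity. On K this forces
phi_n z >= d for all n ([hull_functional_ge]), whereas phi_n tends to 0 pointwise
on K ([hull_functional_cvg0]), a contradiction. *)

Set Implicit Arguments.
Unset Strict Implicit.
Unset Printing Implicit Defensive.

Import Order.TTheory GRing.Theory Num.Theory.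
Import numFieldNormedType.Exports.

Local Open Scope classical_set_scope.
Local Open Scope ring_scope.

(** * A sublinear functional dominates a linear one *)

Section sublinear.
Context {R : realType} {V : lmodType R}.
Implicit Types (p q : V -> R) (x y : V) (t : R).

(** Positive homogeneity is required as an inequality only, which is what infima
provide directly; equality follows ([sublinearZ]). *)
Definition sublinear p :=
  (forall x y, p (x + y) <= p x + p y) /\
  (forall t x, 0 <= t -> p (t *: x) <= t * p x).

Lemma sublinear0 p : sublinear p -> p 0 = 0.
Proof.
case=> pD pZ; apply/eqP; rewrite eq_le; apply/andP; split.
  by have := pZ 0 0 (lexx _); rewrite scale0r mul0r.
by have := pD 0 0; rewrite addr0; lra.
Qed.

Lemma sublinearZ p t x : sublinear p -> 0 <= t -> p (t *: x) = t * p x.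
Proof.
move=> sp; have [pD pZ] := sp; rewrite le_eqVlt => /predU1P[<-|t0].
  by rewrite scale0r mul0r sublinear0.
apply/eqP; rewrite eq_le (pZ _ _ (ltW t0))/=.
have ti : 0 <= t^-1 by rewrite invr_ge0 ltW.
have := pZ t^-1 (t *: x) ti; rewrite scalerA mulVf ?gt_eqF// scale1r.
by rewrite ler_pdivlMl.
Qed.

(** The sublinear functionals needed here are pointwise infima of sets G x that
depend on x in a conic way, up to making values smaller. *)
Lemma inf_sublinear (G : V -> set R) :
    (forall x, G x !=set0) -> (forall x, has_lbound (G x)) ->
    (forall x y r s, G x r -> G y s -> exists2 u, G (x + y) u & u <= r + s) ->
    (forall t x r, 0 <= t -> G x r -> exists2 u, G (t *: x) u & u <= t * r) ->
  sublinear (fun x => inf (G x)).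
Proof.
move=> G0 Glb GD GZ.
have GZ' t x : 0 <= t -> inf (G (t *: x)) <= t * inf (G x).
  rewrite le_eqVlt => /predU1P[<-|t0].
    have [r Gr] := G0 x.
    have [u Gu] := GZ 0 x r (lexx _) Gr.
    by rewrite !mul0r; apply: le_trans; apply: ge_inf.
  rewrite mulrC -ler_pdivrMr//; apply: lb_le_inf => // r Gr.
  rewrite ler_pdivrMr// mulrC.
  have [u Gu] := GZ t x r (ltW t0) Gr.
  by apply: le_trans; apply: ge_inf.
split=> // x y; rewrite -lerBlDl/=.
apply: lb_le_inf => // s Gs.
rewrite lerBlDr -lerBlDl; apply: lb_le_inf => // r Gr.
have [u Gu] := GD _ _ _ _ Gr Gs; rewrite lerBlDr; apply: le_trans.
exact: ge_inf.
Qed.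

(** The functional obtained from q by making it as small as possible along y: its
value at - y is at most - q y. *)
Definition sublinear_shift q y x : R :=
  inf [set r | exists2 t, 0 <= t & r = q (x + t *: y) - t * q y].

Lemma sublinear_shiftP q y : sublinear q ->
  sublinear (sublinear_shift q y) /\
  forall x t, 0 <= t -> sublinear_shift q y x <= q (x + t *: y) - t * q y.
Proof.
move=> sq; have [qD _] := sq.
have lbG x : has_lbound [set r | exists2 t, 0 <= t & r = q (x + t *: y) - t * q y].
  exists (- q (- x)) => _ [t t0 ->].
  have := qD (x + t *: y) (- x).
  by rewrite addrAC subrr add0r (sublinearZ _ sq t0); lra.
split; last by move=> x t t0; apply: ge_inf => //; exists t.
apply: inf_sublinear => //.
- by move=> x; exists (q (x + 0 *: y) - 0 * q y); exists 0.
- move=> x z _ _ [t t0 ->] [s s0 ->].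
  exists (q (x + z + (t + s) *: y) - (t + s) * q y).
    by exists (t + s) => //; exact: addr_ge0.
  by have := qD (x + t *: y) (z + s *: y); rewrite addrACA -scalerDl; lra.
- move=> s x _ s0 [t t0 ->].
  exists (q (s *: x + (s * t) *: y) - (s * t) * q y).
    by exists (s * t) => //; exact: mulr_ge0.
  by rewrite -scalerA -scalerDr (sublinearZ _ sq s0) mulrBr mulrA.
Qed.

(** A minimal q coincides with its shifts along every y, and the case t = 1 of the
infimum then reads q x <= q (x + y) - q y: this is the superadditivity of q. *)
Lemma minimal_sublinear_linear q : sublinear q ->
  (forall r, sublinear r -> (forall x, r x <= q x) -> forall x, q x <= r x) ->
  linear (q : V -> R^o).
Proof.
move=> sq qmin; have [qD _] := sq.
have qsup x y : q x + q y <= q (x + y).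
  have [ss sle] := sublinear_shiftP y sq.
  have ssq z : sublinear_shift q y z <= q z.
    by have := sle z 0 (lexx _); rewrite scale0r addr0 mul0r subr0.
  have := qmin _ ss ssq x; have := sle x 1 ler01.
  by rewrite scale1r mul1r; lra.
have qA x y : q (x + y) = q x + q y by apply/eqP; rewrite eq_le qD qsup.
have qN x : q (- x) = - q x.
  by apply/eqP; rewrite -subr_eq0 opprK -qA addNr sublinear0.
move=> t x y; rewrite qA; congr (_ + _).
have [t0|t0] := leP 0 t; first exact: sublinearZ.
rewrite -[t]opprK scaleNr qN sublinearZ// ?oppr_ge0; last exact: ltW.
by rewrite /GRing.scale/=; ring.
Qed.

(** The analytic form of the Hahn-Banach theorem, without partial functionals:
sublinear functionals below p are bounded below by x |-> - p (- x), so the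
infimum of a chain of them is finite and Zorn's lemma gives a minimal one. *)
Lemma sublinear_minorant p : sublinear p ->
  exists phi : {linear V -> R^o}, forall x, phi x <= p x.
Proof.
move=> sp.
pose T := {q : V -> R | sublinear q /\ forall x, q x <= p x}.
pose below (q r : T) := `[< forall x, sval r x <= sval q x >].
have T0 : T by exists p; split.
have [|||[q [sq qp]] qmin] := @ZL_preorder T T0 below.
- by move=> q; apply/asboolP.
- move=> q r s /asboolP qr /asboolP rs; apply/asboolP => x.
  exact: le_trans (rs x) (qr x).
- move=> A Atot; have [[q0 Aq0]|A0] := pselect (A !=set0); last first.
    by exists T0 => s As; exfalso; apply: A0; exists s.
  pose G x := [set r | exists2 f : T, A f & r = sval f x].
  have lbG x : has_lbound (G x).
    exists (- p (- x)) => _ [[q [sq qp]] _ ->] /=.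
    have [qD _] := sq; have := qD x (- x); rewrite subrr sublinear0//.
    by have := qp (- x); lra.
  have infG (f : T) x : A f -> inf (G x) <= sval f x.
    by move=> Af; apply: ge_inf => //; exists f.
  have sG : sublinear (fun x => inf (G x)).
    apply: inf_sublinear => //.
    + by move=> x; exists (sval q0 x); exists q0.
    + move=> x y _ _ [q Aq ->] [r Ar ->].
      suff [s [As sx sy]] : exists s : T, [/\ A s, sval s x <= sval q x
          & sval s y <= sval r y].
        exists (sval s (x + y)); first by exists s.
        by have [[sD _] _] := svalP s; have := sD x y; lra.
      by have [/asboolP qr|/asboolP rq] := Atot q r Aq Ar; [exists r|exists q].
    + move=> t x _ t0 [q Aq ->]; exists (sval q (t *: x)); first by exists q.
      by have [[_ sZ] _] := svalP q; exact: sZ.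
  have Gp x : inf (G x) <= p x.
    by apply: le_trans (infG _ _ Aq0) _; have [_] := svalP q0.
  exists (exist _ (fun x => inf (G x)) (conj sG Gp)) => s As.
  by apply/asboolP => x /=; exact: infG.
have ql : linear (q : V -> R^o).
  apply: minimal_sublinear_linear => // r sr rq.
  have rp x : r x <= p x by exact: le_trans (rq x) (qp x).
  have qr : below (exist _ q (conj sq qp)) (exist _ r (conj sr rp)).
    exact/asboolP.
  by have /asboolP := qmin _ qr.
pose L := GRing.isLinear.Build R V R^o *:%R (q : V -> R^o) ql.
pose Q : {linear V -> R^o} := HB.pack (q : V -> R^o) L.
by exists Q.
Qed.

End sublinear.

(** * Separation of convex sets and the weak topology *)

Definition segment_closed {R : realType} {V : lmodType R} (S : set V) :=
  forall x y (t : R), S x -> S y -> 0 <= t <= 1 -> S (t *: x + (1 - t) *: y).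

Lemma convex_setE {R : realType} {V : lmodType R} (S : set V) :
  convex_set (S : set (convex_lmodType V)) <-> segment_closed S.
Proof.
split=> [cS x y t Sx Sy /andP[t0 t1]|cS x y t].
  have := cS x y (Itv01 t0 t1) (mem_set Sx) (mem_set Sy).
  by move/set_mem.
move=> /set_mem Sx /set_mem Sy; apply: mem_set.
by apply: cS => //; apply/andP; split.
Qed.

Section separation.
Context {R : realType} {X : normedModType R}.
Implicit Types (S F K : set X) (phi : {linear X -> R^o}).

(** Functionals in the unit ball of the dual, expressed without an operator norm. *)
Definition contractive phi := forall x, `|phi x| <= `|x|.

Lemma contractive_continuous phi : contractive phi -> continuous phi.
Proof.
move=> cphi x; apply/cvgrPdist_lt => e e0; near=> y.
rewrite -raddfB; apply: le_lt_trans (cphi _) _.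
by near: y; exact: cvgr_dist_lt.
Unshelve. all: by end_near. Qed.

(** The functional is a linear minorant of
  p x = inf { |x + t y - f| - d t : t >= 0, y in S, f in F }.
The lower bound d on the distance from S to the subspace F makes the infimum
finite. Choosing t = 0, f = 0 gives p x <= |x|; choosing t = 0, f = x gives
p <= 0 on F; choosing t = 1, f = 0 gives p (- y) <= - d on S. *)
Lemma separation S F (d : R) : 0 <= d -> segment_closed S -> S !=set0 ->
    F 0 -> (forall (a : R) f g, F f -> F g -> F (a *: f + g)) ->
    (forall y f, S y -> F f -> d <= `|y - f|) ->
  exists phi, [/\ contractive phi, forall f, F f -> phi f = 0
                & forall y, S y -> d <= phi y].
Proof.
move=> d0 cS [y0 Sy0] F0 FL dSF.
have FZ a f : F f -> F (a *: f).
  by move=> Ff; rewrite -[_ *: _]addr0; exact: FL.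
have FD f g : F f -> F g -> F (f + g).
  by move=> Ff Fg; rewrite -[f]scale1r; exact: FL.
pose G x := [set r | exists t y f, [/\ 0 <= t, S y, F f
  & r = `|x + t *: y - f| - d * t]].
have lbG x : has_lbound (G x).
  exists (- `|x|) => _ [t [y [f [t0 Sy Ff ->]]]].
  have dt : d * t <= `|t *: y - f|.
    move: t0; rewrite le_eqVlt => /predU1P[<-|t0]; first by rewrite mulr0.
    have -> : t *: y - f = t *: (y - t^-1 *: f).
      by rewrite scalerBr scalerA divff ?scale1r// gt_eqF.
    rewrite normrZ gtr0_norm// mulrC ler_pM2l//.
    by apply: dSF => //; exact: FZ.
  have := ler_normB (x + t *: y - f) x.
  by rewrite addrAC [x + _ - x]addrAC subrr add0r; lra.
have sG : sublinear (fun x => inf (G x)).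
  apply: inf_sublinear => //.
  - by move=> x; exists (`|x + 0 *: y0 - 0| - d * 0); exists 0, y0, 0.
  - move=> x z _ _ [t [y [f [t0 Sy Ff ->]]]] [s [w [g [s0 Sw Fg ->]]]].
    (* for t + s > 0, v is the convex combination with weights t and s *)
    have [v Sv tsv] : exists2 v, S v & t *: y + s *: w = (t + s) *: v.
      have [ts0|ts0] := eqVneq (t + s) 0.
        exists y => //; have [-> ->] : t = 0 /\ s = 0 by split; lra.
        by rewrite addr0 !scale0r addr0.
      have ts : 0 < t + s by rewrite lt_neqAle eq_sym ts0 addr_ge0.
      exists (t / (t + s) *: y + (1 - t / (t + s)) *: w).
        apply: cS => //; rewrite divr_ge0 ?addr_ge0//=.
        by rewrite ler_pdivrMr// mul1r lerDl.
      rewrite scalerDr !scalerA mulrBr mulr1 mulrCA divff// mulr1.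
      by rewrite addrAC subrr add0r.
    exists (`|x + z + (t + s) *: v - (f + g)| - d * (t + s)).
      by exists (t + s), v, (f + g); split => //; [exact: addr_ge0|exact: FD].
    have := ler_normD (x + t *: y - f) (z + s *: w - g).
    rewrite addrACA -opprD addrACA tsv; lra.
  - move=> s x _ s0 [t [y [f [t0 Sy Ff ->]]]].
    exists (`|s *: x + (s * t) *: y - s *: f| - d * (s * t)).
      by exists (s * t), y, (s *: f); split => //; [exact: mulr_ge0|exact: FZ].
    rewrite -scalerA -scalerDr -scalerBr normrZ ger0_norm//.
    by rewrite mulrBr mulrCA.
have [phi phiG] := sublinear_minorant sG.
have phi_le x t y f : 0 <= t -> S y -> F f -> phi x <= `|x + t *: y - f| - d * t.
  move=> t0 Sy Ff; apply: le_trans (phiG x) _; apply: ge_inf => //.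
  by exists t, y, f.
have phi1 x : phi x <= `|x|.
  by have := phi_le x 0 y0 0 (lexx _) Sy0 F0;
    rewrite scale0r addr0 subr0 mulr0 subr0.
have phi0 f : F f -> phi f <= 0.
  move=> Ff; have := phi_le f 0 y0 f (lexx _) Sy0 Ff.
  by rewrite scale0r addr0 subrr normr0 mulr0 subr0.
exists phi; split.
- move=> x; rewrite ler_norml phi1 andbT lerNl -raddfN.
  by apply: le_trans (phi1 _) _; rewrite normrN.
- move=> f Ff; apply/eqP; rewrite eq_le phi0//= -oppr_le0 -raddfN phi0//.
  by rewrite -scaleN1r; exact: FZ.
- move=> y Sy; have := phi_le (- y) 1 y 0 ler01 Sy F0.
  by rewrite scale1r addNr subr0 normr0 mulr1 raddfN; lra.
Qed.

Lemma closed_convex_separation K p : closed K -> segment_closed K -> K !=set0 ->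
  ~ K p -> exists2 phi, contractive phi &
    exists2 d : R, 0 < d & forall y, K y -> phi p + d <= phi y.
Proof.
move=> clK cK [y0 Ky0] Kp.
have [d d0 dK] : exists2 d : R, 0 < d & forall y, K y -> d <= `|p - y|.
  have : nbhs p (~` K) by apply: open_nbhs_nbhs; split => //; exact: closed_openC.
  move=> /nbhs_normP[d /= d0 dK]; exists d => // y Ky.
  by rewrite leNgt; apply/negP => /dK; apply.
have [||//|||phi [cphi _ phid]] :=
    @separation [set y - p | y in K] [set 0] d (ltW d0).
- move=> _ _ t [x Kx <-] [y Ky <-] t01.
  exists (t *: x + (1 - t) *: y); first exact: cK.
  by rewrite !scalerBr addrACA -opprD -scalerDl addrCA subrr addr0 scale1r.
- by exists (y0 - p), y0.
- by move=> a _ _ -> ->; rewrite /= scaler0 addr0.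
- by move=> _ _ [y Ky <-] ->; rewrite subr0 distrC; exact: dK.
exists phi => //; exists d => // y Ky.
by have := phid (y - p) (imageP _ Ky); rewrite raddfB; lra.
Qed.

Lemma norming_functional (x : X) :
  exists2 phi, contractive phi & `|x| <= phi x.
Proof.
have [|||||phi [cphi _ phix]] :=
    @separation [set x] [set 0] `|x| (normr_ge0 x).
- by move=> _ _ t -> -> _ /=; rewrite -scalerDl addrC subrK scale1r.
- by exists x.
- by [].
- by move=> a _ _ -> ->; rewrite /= scaler0 addr0.
- by move=> _ _ -> ->; rewrite subr0.
- by exists phi => //; exact: phix.
Qed.

End separation.

Section weak_topology_facts.
Context {R : realType} {X : normedModType R}.

Lemma weak_nbhs_preimage (phi : {linear X -> R^o}) (p : X) (A : set R^o) :
  continuous phi -> nbhs (phi p) A ->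
  nbhs (p : weak_topology X) (phi @^-1` A).
Proof.
move=> cphi Ap.
pose Tc (psi : topological_dual X) :=
  Topological.class (initial_topology (sval psi : X -> R^o)).
have [+ _] := @cvg_sup X _ Tc (nbhs (p : weak_topology X)) p
  (nbhs_filter (p : weak_topology X)).
move=> /(_ (fun _ h => h) (exist _ phi cphi)); apply.
exact: (@initial_continuous X R^o phi).
Qed.

(** Functionals of norm at most one suffice, by rescaling. *)
Lemma weak_cvgP (F : set_system X) (p : X) : Filter F ->
  (forall phi : {linear X -> R^o}, contractive phi -> phi @ F --> phi p) ->
  F --> (p : weak_topology X).
Proof.
move=> FF Fp; apply/cvg_sup => -[phi cphi] A /= [_ [[B Bop <-] Bp BA]].
apply: filterS BA _; apply: (_ : phi @ F --> phi p); last first.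
  exact: open_nbhs_nbhs.
have [k k0 phik] := linear_lipschitz cphi.
have cpsi : contractive (k^-1 \*: phi).
  move=> x /=; rewrite normrZ gtr0_norm ?invr_gt0// ler_pdivrMl//.
apply/cvgrPdist_lt => e e0.
have /cvgrPdist_lt/(_ (k^-1 * e)) := Fp _ cpsi.
rewrite mulr_gt0 ?invr_gt0// => /(_ isT); apply: filterS => x /=.
by rewrite -scalerBr normrZ gtr0_norm ?invr_gt0// ltr_pM2l// invr_gt0.
Qed.

(** Mazur's theorem in terms of filters: a functional that separates p from K
defines a weak neighbourhood of p disjoint from K. *)
Lemma weak_cluster_closed_convex (F : set_system X) (K : set X) (p : X) :
  ProperFilter F -> closed K -> segment_closed K -> F K ->
  cluster (F : set_system (weak_topology X)) p -> K p.
Proof.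
move=> FF clK cK FK Fp; apply: contrapT => Kp.
have [phi cphi [d d0 dK]] :=
  closed_convex_separation clK cK (filter_ex FK) Kp.
have [|y [Ky /= phiy]] := Fp K (phi @^-1` [set z | z < phi p + d]) FK.
  apply: weak_nbhs_preimage; first exact: contractive_continuous.
  by apply: lt_nbhsl; rewrite ltrDl.
by have := dK _ Ky; rewrite leNgt phiy.
Qed.

End weak_topology_facts.

(** * Fixed points on weakly compact sets *)

Section weak_compactness_implies_fixed_points.
Context {R : realType} {X : normedModType R}.
Variables (K : set X) (f : X -> X).
Hypotheses (cK : segment_closed K) (fK : forall x, K x -> K (f x)).
Hypothesis aff : affine_on K f.

(** The point y is the mean of x0, f x0, ..., f^n x0; since f is affine, f y - y
telescopes. *)
Lemma affine_self_map_cesaro (x0 : X) (n : nat) : K x0 ->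
  exists2 y, K y & n.+1%:R *: (f y - y) = iter n.+1 f x0 - x0.
Proof.
move=> Kx0; have Kit k : K (iter k f x0) by elim: k => //= k; exact: fK.
elim: n => [|n [y Ky IH]]; first by exists x0; rewrite ?scale1r.
have n2 : n.+2%:R != 0 :> R by rewrite pnatr_eq0.
pose t : R := n.+1%:R / n.+2%:R.
have t01 : 0 <= t <= 1.
  by rewrite divr_ge0//= ler_pdivrMr ?ltr0n// mul1r ler_nat.
have t1 : 1 - t = n.+2%:R^-1.
  by rewrite /t -[X in X - _](divff n2) -mulrBl -natrB// subSnn div1r.
exists (t *: y + (1 - t) *: iter n.+1 f x0); first exact: cK.
rewrite aff// opprD addrACA -!scalerBr scalerDr !scalerA t1 divff// scale1r.
by rewrite /t mulrCA divff// mulr1 IH -iterS addrC addrA subrK.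
Qed.

Lemma affine_almost_fixed (M e : R) : (forall x, K x -> `|x| <= M) ->
  K !=set0 -> 0 < e -> exists2 y, K y & `|f y - y| <= e.
Proof.
move=> KM [x0 Kx0] e0.
pose n := Num.truncn (2 * M / e).
have [y Ky yn] := affine_self_map_cesaro n Kx0; exists y => //.
have Kit k : K (iter k f x0) by elim: k => //= k; exact: fK.
have M0 : 0 <= M by apply: le_trans (KM _ Kx0).
have nM : 2 * M <= n.+1%:R * e.
  by rewrite -ler_pdivrMr// ltW// truncnS_gt.
have : n.+1%:R * `|f y - y| <= 2 * M.
  rewrite -[n.+1%:R]ger0_norm// -normrZ yn.
  apply: le_trans (ler_normB _ _) _.
  by have := KM _ Kx0; have := KM _ (Kit n.+1); lra.
by move=> /le_trans/(_ nM); rewrite ler_pM2l// ltr0n.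
Qed.

(** The sets Ke e of e-almost fixed points form a filter base of closed convex
sets, so a weak cluster point of it lies in all of them. *)
Lemma weakly_compact_fixed_point (C : set X) (c : R) :
    weakly_compact C -> K `<=` C -> K !=set0 -> bounded_set K -> closed K ->
    (forall x y, K x -> K y -> `|f x - f y| <= c * `|x - y|) ->
  exists2 x, K x & f x = x.
Proof.
move=> wC KC K0 bK clK lipf.
have [M KM] : exists M : R, forall x, K x -> `|x| <= M.
  by have [M [_ MK]] := bK; exists (M + 1) => x Kx; apply: MK => //; lra.
pose Ke (e : R) := [set x | K x /\ `|f x - x| <= e].
have clKe e : closed (Ke e).
  move=> p clp.
  have Kp : K p by apply: clK => A /clp[x [[Kx _] Ax]]; exists x.
  split=> //; apply/ler_addgt0Pr => d d0.
  have c1 : 0 < `|c| + 1 by rewrite ltr_wpDl.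
  have dc : 0 < d / (`|c| + 1) by rewrite divr_gt0.
  have [x [[Kx xe] /= px]] := clp _ (nbhsx_ballx p _ dc).
  move: px; rewrite -ball_normE /= ltr_pdivlMr// => px.
  have -> : f p - p = (f p - f x) + (f x - x) - (p - x).
    by rewrite addrA subrK opprB addrA subrK.
  have h1 := ler_normB (f p - f x + (f x - x)) (p - x).
  have h2 := ler_normD (f p - f x) (f x - x).
  have h3 := lipf _ _ Kp Kx.
  have h4 : c * `|p - x| <= `|c| * `|p - x| by rewrite ler_wpM2r// ler_norm.
  by nra.
have cvKe e : segment_closed (Ke e).
  move=> x y t [Kx xe] [Ky ye] /[dup] t01 /andP[t0 t1].
  split; first exact: cK.
  rewrite aff// opprD addrACA -!scalerBr.
  apply: le_trans (ler_normD _ _) _; rewrite !normrZ !ger0_norm ?subr_ge0//.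
  have : t * `|f x - x| <= t * e by rewrite ler_wpM2l.
  have : (1 - t) * `|f y - y| <= (1 - t) * e by rewrite ler_wpM2l// subr_ge0.
  by lra.
pose F : set_system X := filter_from [set e : R | 0 < e] Ke.
have FF : ProperFilter F.
  apply: filter_from_proper; last first.
    by move=> e e0; have [y Ky ye] := affine_almost_fixed KM K0 e0; exists y.
  apply: filter_from_filter; first by exists 1; exact: ltr01.
  move=> d e /= d0 e0; exists (Num.min d e); first by rewrite /= lt_min d0.
  by move=> x [Kx]; rewrite le_min => /andP[xd xe].
have [|p [_ Fp]] := wC F FF.
  by exists 1 => [|x [Kx _]]; [exact: ltr01|exact: KC].
have pe e : 0 < e -> Ke e p.
  by move=> e0; apply: (weak_cluster_closed_convex FF) => //; exists e.
have [Kp _] := pe 1 ltr01; exists p => //.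
apply/eqP; rewrite -subr_eq0 -normr_le0; apply/ler_addgt0Pr => e /pe[_].
by rewrite add0r.
Qed.

End weak_compactness_implies_fixed_points.

(** * Ultrafilters without weak limit *)

Section ultrafilter_without_weak_limit.
Context {R : realType} {X : completeNormedModType R}.
Variables (U : set_system X) (C : set X) (M : R).
Hypotheses (ultraU : UltraFilter U) (UC : U C).
Hypothesis CM : forall x, C x -> `|x| <= M.

Lemma ultrafilter_functional_cvg (phi : {linear X -> R^o}) :
  contractive phi -> exists theta : R, phi @ U --> (theta : R^o).
Proof.
move=> cphi; have PU : ProperFilter U by exact: ultra_proper.
have [|theta [_ clt]] := @segment_compact R (- M) M (phi @ U) _.
  apply: (@filterS _ U _ C) => // x Cx /=; rewrite in_itv/= -ler_norml.
  have phiM := le_trans (cphi x) (CM Cx); exact: phiM.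
exists theta => A At; have [//|UnA] := in_ultra_setVsetC (phi @^-1` A) ultraU.
by have [y [nAy Ay]] := clt (~` A) A UnA At.
Qed.

(** Let x'' be the point of the bidual given by phi |-> lim_U phi. The hypothesis on
x says that x is within d of every convex member of U, and the conclusion says
that x'' - x has norm at most d: sublevel sets of |theta - phi _| are convex. *)
Lemma limit_near_point (phi : {linear X -> R^o}) (theta d : R) (x : X) :
    (forall S, U S -> segment_closed S -> exists2 y, S y & `|x - y| <= d) ->
    contractive phi -> phi @ U --> (theta : R^o) ->
  `|theta - phi x| <= d.
Proof.
move=> xd cphi phiU; have PU : ProperFilter U by exact: ultra_proper.
apply/ler_addgt0Pr => e e0.
have Ue : U [set y | `|theta - phi y| <= e].
  by move/cvgrPdist_le : phiU => /(_ e e0).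
have [|y /= ye yd] := xd _ Ue.
  move=> y z t /= ye ze /andP[t0 t1]; rewrite linearP linearZ/=.
  have -> : theta - (t *: phi y + (1 - t) *: phi z) =
      t * (theta - phi y) + (1 - t) * (theta - phi z).
    by rewrite /GRing.scale/=; ring.
  have t1' : 0 <= 1 - t by rewrite subr_ge0.
  apply: le_trans (ler_normD _ _) _.
  rewrite !normrM (ger0_norm t0) (ger0_norm t1').
  have : t * `|theta - phi y| <= t * e by rewrite ler_wpM2l.
  have : (1 - t) * `|theta - phi z| <= (1 - t) * e by rewrite ler_wpM2l.
  by lra.
have := cphi (x - y); rewrite raddfB => xy.
have -> : theta - phi x = (theta - phi y) - (phi x - phi y) by ring.
by apply: le_trans (ler_normB _ _) _; lra.
Qed.

(** Otherwise X contains points x_n within 1/(n+1) of the limit of U in the bidual.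
They form a Cauchy sequence, and its limit would be a weak limit of U. *)
Lemma uniform_gap :
    (forall p, ~ forall phi : {linear X -> R^o}, contractive phi ->
      phi @ U --> phi p) ->
  exists2 d : R, 0 < d & forall x, exists S,
    [/\ U S, segment_closed S & forall y, S y -> d < `|x - y|].
Proof.
move=> Up; have PU : ProperFilter U by exact: ultra_proper.
apply: contrapT => gap.
pose close x d :=
  forall S, U S -> segment_closed S -> exists2 y, S y & `|x - y| <= d.
have /choice[x xclose] : forall n, exists x, close x n.+1%:R^-1.
  move=> n; apply: contrapT => nclose; apply: gap.
  exists n.+1%:R^-1; first by rewrite invr_gt0.
  move=> x; apply: contrapT => nS; apply: nclose; exists x => S US cS.
  apply: contrapT => ny; apply: nS; exists S; split => // y Sy.
  by rewrite ltNge; apply/negP => xy; apply: ny; exists y.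
have xx m n : `|x m - x n| <= m.+1%:R^-1 + n.+1%:R^-1.
  have [phi cphi] := norming_functional (x m - x n); rewrite raddfB => le1.
  have [theta phiU] := ultrafilter_functional_cvg cphi.
  have := limit_near_point (xclose m) cphi phiU.
  have := limit_near_point (xclose n) cphi phiU.
  rewrite !ler_norml => /andP[_ nu] /andP[ml _].
  by move: (m.+1%:R^-1) (n.+1%:R^-1) nu ml => a b; lra.
have xcvg : cvgn x.
  apply/cauchy_cvgP; apply: cauchy_exP => e e0.
  have e2 : 0 < e / 2 by rewrite divr_gt0.
  near \oo => N; exists (x N).
  suff : \forall k \near \oo, ball (x N) e (x k) by [].
  near=> k.
  rewrite -ball_normE /=; apply: le_lt_trans (xx _ _) _.
  rewrite (splitr e) ltrD//.
    by near: N; exact: (near_infty_natSinv_lt (PosNum e2)).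
  by near: k; exact: (near_infty_natSinv_lt (PosNum e2)).
apply: (Up (limn x)) => phi cphi.
have [theta phiU] := ultrafilter_functional_cvg cphi.
suff -> : phi (limn x) = theta by [].
apply/eqP; rewrite eq_sym -subr_eq0 -normr_le0; apply/ler_addgt0Pr => e e0.
rewrite add0r; have e2 : 0 < e / 2 by rewrite divr_gt0.
have /cvgrPdist_lt/(_ _ e2) xnear : x @ \oo --> limn x by exact: xcvg.
near \oo => n.
have xe : `|limn x - x n| <= e / 2.
  by apply: ltW; near: n; exact: xnear.
have ne : n.+1%:R^-1 < e / 2.
  by near: n; exact: (near_infty_natSinv_lt (PosNum e2)).
have h1 := limit_near_point (xclose n) cphi phiU.
have := cphi (limn x - x n); rewrite raddfB => h2.
have -> : theta - phi (limn x) =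
  (theta - phi (x n)) - (phi (limn x) - phi (x n)) by ring.
apply: le_trans (ler_normB _ _) _.
by move: (n.+1%:R^-1) ne h1 => w; lra.
Unshelve. all: by end_near. Qed.

End ultrafilter_without_weak_limit.

(** * Coefficients of triangular systems *)

Section triangular_systems.
Context {R : realType} {X : normedModType R}.
Implicit Types (x : nat -> X) (phi : nat -> {linear X -> R^o}).
Implicit Types (theta eps c : nat -> R).

(** A matrix phi_j (x_k) that is zero below the diagonal and, up to the error eps k
in column k, constant along each row from the diagonal on. Only indices smaller
than n are constrained, so that such systems can be built by recursion. *)
Definition triangular (d : R) eps n x phi theta := forall j, (j < n)%N ->
  [/\ contractive (phi j), d <= theta j,
      forall i, (i < j)%N -> phi j (x i) = 0
    & forall k, (j <= k < n)%N -> `|phi j (x k) - theta j| <= eps k].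

(** Let m be the largest modulus of the tails s_i = c_i + ... + c_(n-1). Applying
phi_i to the combination gives theta_i s_i up to an error of at most
sum_k |c_k| eps_k <= 2 m (d / 4). Taking the i that attains m yields
d m <= 2 |sum_k c_k x_k|, and |c_j| <= 2 m. *)
Lemma triangular_coef_bound d eps n x phi theta c j : 0 < d ->
    (forall k, 0 <= eps k) -> \sum_(0 <= k < n) eps k <= d / 4 ->
    triangular d eps n x phi theta -> (j < n)%N ->
  d * `|c j| <= 4 * `|\sum_(0 <= k < n) c k *: x k|.
Proof.
move=> d0 eps0 sumeps tri jn.
set N := (X in _ <= 4 * X).
pose s i := \sum_(i <= k < n) c k.
have cs k : (k < n)%N -> c k = s k - s k.+1.
  by move=> kn; rewrite /s big_ltn// addrK.
pose m := \big[Num.max/0]_(i < n) `|s i|.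
have m0 : 0 <= m by exact: bigmax_ge_id.
have sm i : (i <= n)%N -> `|s i| <= m.
  rewrite leq_eqVlt => /predU1P[->|ltin]; first by rewrite /s big_geq// normr0.
  exact: (le_bigmax _ (fun i : 'I_n => `|s i|) (Ordinal ltin)).
have cm k : (k < n)%N -> `|c k| <= 2 * m.
  move=> kn; rewrite cs//; apply: le_trans (ler_normB _ _) _.
  by have := sm _ kn; have := sm _ (ltnW kn); lra.
have sN i : (i < n)%N -> d * `|s i| <= N + m * (d / 2).
  move=> ltin; have [cphi dth phi0 phith] := tri _ ltin.
  have phiN : `|\sum_(0 <= k < n) c k * phi i (x k)| <= N.
    have -> : \sum_(0 <= k < n) c k * phi i (x k) =
        phi i (\sum_(0 <= k < n) c k *: x k).
      by rewrite linear_sum; apply: eq_bigr => k _; rewrite linearZ.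
    exact: cphi.
  rewrite (big_cat_nat (leq0n i) (ltnW ltin))/= big_nat big1 ?add0r in phiN;
    last by move=> k /andP[_ ki]; rewrite phi0// mulr0.
  have split_sum : \sum_(i <= k < n) c k * phi i (x k) =
      theta i * s i + \sum_(i <= k < n) c k * (phi i (x k) - theta i).
    rewrite /s mulr_sumr -big_split/=; apply: eq_bigr => k _.
    by ring.
  have err : `|\sum_(i <= k < n) c k * (phi i (x k) - theta i)| <= m * (d / 2).
    apply: le_trans (ler_norm_sum _ _ _) _.
    apply: (@le_trans _ _ (2 * m * \sum_(i <= k < n) eps k)).
      rewrite mulr_sumr ler_sum_nat// => k /[dup] ikn /andP[ik kn].
      by rewrite normrM ler_pM// ?phith// cm.
    have : \sum_(i <= k < n) eps k <= \sum_(0 <= k < n) eps k.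
      by rewrite [leRHS](big_cat_nat (leq0n i) (ltnW ltin))/= lerDr sumr_ge0.
    by move/le_trans => /(_ _ sumeps) => /(ler_wpM2l (mulr_ge0 (ler0n R 2) m0)); lra.
  have : `|theta i * s i| <= N + m * (d / 2).
    rewrite -[theta i * s i](addrK (\sum_(i <= k < n) c k * (phi i (x k) - theta i))).
    by rewrite -split_sum; apply: le_trans (ler_normB _ _) _; exact: lerD.
  apply: le_trans; rewrite normrM ler_wpM2r//.
  exact: le_trans dth (ler_norm _).
have dm : d * m <= N + m * (d / 2).
  rewrite mulrC -ler_pdivlMr//; apply: bigmax_le.
    have md0 : 0 <= m * (d / 2) by rewrite mulr_ge0// divr_ge0// ltW.
    by apply: divr_ge0 (ltW d0); rewrite addr_ge0// normr_ge0.
  by move=> i _; rewrite ler_pdivlMr// mulrC sN.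
by have := ler_wpM2l (ltW d0) (cm _ jn); lra.
Qed.

End triangular_systems.

(** * Functionals vanishing on a finite span *)

Section linear_combinations.
Context {R : realType} {X : normedModType R}.

Lemma lincomb_continuous n (x : nat -> X) :
  continuous (fun v : 'rV[R]_n => \sum_(i < n) v ord0 i *: x i).
Proof.
apply: continuous_big => [|i _ v]; first exact: add_continuous.
by apply: (cvgZ (@coord_continuous R 1 n ord0 i v)); exact: cvg_cst.
Qed.

Lemma lincomb_widen n m (c : nat -> R) (x : nat -> X) : (n <= m)%N ->
  \sum_(0 <= k < n) c k *: x k =
  \sum_(0 <= k < m) (if (k < n)%N then c k else 0) *: x k.
Proof.
move=> nm; rewrite [RHS](big_cat_nat (leq0n n) nm)/= [X in _ + X]big_nat.
rewrite [X in _ + X]big1 ?addr0; last first.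
  by move=> k /andP[nk _]; rewrite ltnNge nk scale0r.
by rewrite !big_nat; apply: eq_bigr => k /andP[_ ->].
Qed.

End linear_combinations.

Section triangular_existence.
Context {R : realType} {X : normedModType R}.
Variables (U : set_system X) (C : set X) (M d0 d : R).
Hypotheses (PU : ProperFilter U) (UC : U C) (cC : segment_closed C).
Hypothesis CM : forall x, C x -> `|x| <= M.
Hypothesis functional_cvg : forall phi : {linear X -> R^o},
  contractive phi -> exists theta : R, phi @ U --> (theta : R^o).
Hypotheses (d_gt0 : 0 < d) (dd0 : d < d0).
Hypothesis gap : forall x, exists S,
  [/\ U S, segment_closed S & forall y, S y -> d0 < `|x - y|].

(** If all convex members of U came within d of the span of the x_k, k < n, the
approximating coefficients would be bounded, by the coefficient estimate, and
cluster at some v. The combination with coefficients v would then be within d0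
of all convex members of U, contradicting the gap around that point. *)
Lemma span_gap n (x : nat -> X) :
    (forall c j, (j < n)%N ->
      d * `|c j| <= 4 * `|\sum_(0 <= k < n) c k *: x k|) ->
  exists S, [/\ U S, segment_closed S
    & forall c y, S y -> d <= `|y - \sum_(0 <= k < n) c k *: x k|].
Proof.
move=> coef; apply: contrapT => nS.
have approx S : U S -> segment_closed S ->
    exists c y, S y /\ `|y - \sum_(0 <= k < n) c k *: x k| < d.
  move=> US cS; apply: contrapT => ncy; apply: nS; exists S; split => // c y Sy.
  by rewrite leNgt; apply/negP => yd; apply: ncy; exists c, y.
pose B := 4 * (M + d) / d.
pose box := [set v : 'rV[R]_n | forall i, `[- B, B]%classic (v ord0 i)].
have cbox : compact box.
  exact: (rV_compact (fun=> @segment_compact R (- B) B)).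
pose g (v : 'rV[R]_n) := \sum_(i < n) v ord0 i *: x i.
pose near_set S := [set v | box v /\ exists2 y, S y & `|y - g v| < d].
pose F := filter_from [set S | U S /\ segment_closed S] near_set.
have FF : ProperFilter F.
  apply: filter_from_proper.
    apply: filter_from_filter; first by exists C.
    move=> S1 S2 [US1 cS1] [US2 cS2]; exists (S1 `&` S2).
      split; first exact: filterI.
      by move=> y z t [? ?] [? ?] t01; split; [exact: cS1|exact: cS2].
    by move=> v [bv [y [S1y S2y] yv]]; split; split => //; exists y.
  move=> S [US cS].
  have [||c [y [[Sy Cy] yc]]] := approx (S `&` C).
  - exact: filterI.
  - by move=> y z t [? ?] [? ?] t01; split; [exact: cS|exact: cC].
  have gc : g (\row_i c i) = \sum_(0 <= k < n) c k *: x k.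
    by rewrite big_mkord /g; apply: eq_bigr => i _; rewrite mxE.
  exists (\row_i c i); split; last by exists y => //; rewrite gc.
  move=> i; rewrite /= mxE in_itv/= -ler_norml /B ler_pdivlMr// mulrC.
  apply: le_trans (coef c i (ltn_ord i)) _; rewrite ler_pM2l//.
  rewrite -[X in `|X|](subKr y); apply: le_trans (ler_normB _ _) _.
  by rewrite lerD ?CM// ltW.
have [|v [_ clv]] := cbox F FF.
  by exists C => // w [].
have [S [US cS Sgap]] := gap (g v).
have [||w [[_ [y Sy yw]] /= vw]] := clv (near_set S) (g @^-1` ball (g v) (d0 - d)).
- by exists S.
- apply: (@lincomb_continuous _ _ n x v); apply: nbhsx_ballx.
  by rewrite subr_gt0.
have := Sgap _ Sy; rewrite ltNge => /negP; apply.
move: vw; rewrite -ball_normE /= => vw.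
have -> : g v - y = (g v - g w) - (y - g w) by rewrite opprB addrA subrK.
by apply: le_trans (ler_normB _ _) _; lra.
Qed.

(** The counterpart of Helly's lemma: the point of the bidual given by U is
separated from a finite-dimensional subspace by an element of the dual. *)
Lemma next_functional n (x : nat -> X) :
    (forall c j, (j < n)%N ->
      d * `|c j| <= 4 * `|\sum_(0 <= k < n) c k *: x k|) ->
  exists (phi : {linear X -> R^o}) (theta : R), [/\ contractive phi,
    phi @ U --> (theta : R^o), d <= theta & forall i, (i < n)%N -> phi (x i) = 0].
Proof.
move=> /span_gap[S [US cS Sd]].
pose F := [set f | exists c : nat -> R, f = \sum_(0 <= k < n) c k *: x k].
have F0 : F 0.
  by exists (fun=> 0); rewrite big1// => k _; rewrite scale0r.
have FL (a : R) f g : F f -> F g -> F (a *: f + g).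
  move=> [b ->] [c ->]; exists (fun k => a * b k + c k).
  rewrite scaler_sumr -big_split/=; apply: eq_bigr => k _.
  by rewrite scalerDl scalerA.
have SF y f : S y -> F f -> d <= `|y - f| by move=> Sy [c ->]; exact: Sd.
have [phi [cphi phiF phiS]] :=
  separation (ltW d_gt0) cS (filter_ex US) F0 FL SF.
have [theta phiU] := functional_cvg cphi.
exists phi, theta; split => //.
- apply/ler_addgt0Pr => e e0.
  have /cvgrPdist_lt/(_ e e0) Ue := phiU.
  have [y [/phiS dy /= ]] := filter_ex (filterI US Ue).
  by rewrite ltr_norml => /andP[? _]; lra.
- move=> i ltin; apply: phiF; exists (fun k => (k == i)%:R).
  rewrite big_mkord (bigD1 (Ordinal ltin))//= eqxx scale1r big1 ?addr0// => k ki.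
  by rewrite -[(k == i :> nat)]/(k == Ordinal ltin) (negbTE ki) scale0r.
Qed.

End triangular_existence.

(** * Triangular and biorthogonal sequences *)

(** Dependent choice for a property P n u of the first n terms of u: a sequence all
of whose prefixes are good exists as soon as every good prefix can be extended. *)
Lemma dependent_choice_prefix (T : Type) (t0 : T) (P : nat -> (nat -> T) -> Prop) :
    (forall n u v, (forall k, (k < n)%N -> u k = v k) -> P n u -> P n v) ->
    (forall u, P 0%N u) ->
    (forall n u, P n u -> exists t, P n.+1 (fun k => if k == n then t else u k)) ->
  exists u, forall n, P n u.
Proof.
move=> Ploc P0 PS.
have /choice[g gP] : forall a : nat * (nat -> T), exists t, P a.1 a.2 ->
    P a.1.+1 (fun k => if k == a.1 then t else a.2 k).
  move=> [n u] /=; have [/PS[t Pt]|nP] := pselect (P n u); first by exists t.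
  by exists t0.
pose w := fix w n := if n is m.+1
  then (fun k => if k == m then g (m, w m) else w m k) else fun=> t0.
have Pw n : P n (w n) by elim: n => [|n /(gP (n, _))]; first exact: P0.
have wS n k : (k < n)%N -> w n k = w k.+1 k.
  elim: n => // n IH; rewrite ltnS leq_eqVlt => /predU1P[->//|kn].
  by rewrite /= ltn_eqF// IH.
exists (fun k => w k.+1 k) => n.
by apply: (Ploc n (w n)) (Pw n) => k; exact: wS.
Qed.

Definition geometric_error {R : realType} (d : R) (k : nat) := d / 4 / 2 ^+ k.+1.

Lemma sum_geometric_error {R : realType} (d : R) n : 0 <= d ->
  \sum_(0 <= k < n) geometric_error d k <= d / 4.
Proof.
move=> d0.
suff -> : \sum_(0 <= k < n) geometric_error d k = d / 4 - d / 4 / 2 ^+ n.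
  by rewrite gerBl divr_ge0// divr_ge0.
elim: n => [|n IH]; first by rewrite big_geq// expr0 divr1 subrr.
rewrite big_nat_recr//= IH /geometric_error exprS invfM.
by move: (2 ^+ n)^-1 => z; lra.
Qed.

Section triangular_sequence.
Context {R : realType} {X : normedModType R}.
Variables (U : set_system X) (C : set X) (M d0 d : R).
Hypotheses (PU : ProperFilter U) (UC : U C) (cC : segment_closed C).
Hypothesis CM : forall x, C x -> `|x| <= M.
Hypothesis functional_cvg : forall phi : {linear X -> R^o},
  contractive phi -> exists theta : R, phi @ U --> (theta : R^o).
Hypotheses (d_gt0 : 0 < d) (dd0 : d < d0).
Hypothesis gap : forall x, exists S,
  [/\ U S, segment_closed S & forall y, S y -> d0 < `|x - y|].

Let eps := geometric_error d.

Let eps_gt0 k : 0 < eps k.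
Proof. by rewrite /eps /geometric_error !divr_gt0// exprn_gt0. Qed.

(** A good prefix also records that its functionals converge along U to their
constants theta; this is what makes the set of admissible next points a member
of U, hence nonempty. *)
Lemma triangular_sequence : exists x phi theta,
  (forall k, C (x k)) /\ forall n, triangular d eps n x phi theta.
Proof.
pose T := (X * {linear X -> R^o} * R)%type.
pose P n (u : nat -> T) :=
  triangular d eps n (fun k => (u k).1.1) (fun k => (u k).1.2) (fun k => (u k).2)
  /\ forall k, (k < n)%N -> C (u k).1.1 /\ (u k).1.2 @ U --> ((u k).2 : R^o).
pose t0 : T := (0, (\0%R : {linear X -> R^o}), 0).
have [||| u uP] := @dependent_choice_prefix T t0 P; last first.
- exists (fun k => (u k).1.1), (fun k => (u k).1.2), (fun k => (u k).2).
  by split=> [k|n]; [have [_ /(_ k (ltnSn k))[]] := uP k.+1|have [] := uP n].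
- move=> n u [tri lim].
  pose x k := (u k).1.1; pose phi k := (u k).1.2; pose theta k := (u k).2.
  have coef c j : (j < n)%N -> d * `|c j| <= 4 * `|\sum_(0 <= k < n) c k *: x k|.
    move=> jn; apply: (@triangular_coef_bound _ _ d eps n x phi theta) => //.
    + by move=> k; exact: ltW.
    + exact: sum_geometric_error (ltW d_gt0).
  have [psi [th [cpsi psiU dth psi0]]] :=
    next_functional PU UC cC CM functional_cvg d_gt0 dd0 gap coef.
  have nearU j : (j < n)%N -> U [set y | `|phi j y - theta j| <= eps n].
    move=> /lim[_ /cvgrPdist_le/(_ _ (eps_gt0 n))].
    by apply: filterS => y /=; rewrite distrC.
  have nearsU : U [set y | forall j : 'I_n, `|phi j y - theta j| <= eps n].
    by apply: filter_forall => j; exact: nearU.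
  have psinU : U [set y | `|psi y - th| <= eps n].
    move: psiU => /cvgrPdist_le/(_ _ (eps_gt0 n)).
    by apply: filterS => y /=; rewrite distrC.
  have [y [[Cy phiy] psiy]] := filter_ex (filterI (filterI UC nearsU) psinU).
  exists (y, psi, th); split; last first.
    move=> k; rewrite ltnS leq_eqVlt => /predU1P[->|kn]; first by rewrite eqxx.
    by rewrite ltn_eqF//; exact: lim.
  move=> j; rewrite ltnS leq_eqVlt => /predU1P[->|jn].
    rewrite eqxx/=; split => //.
    + by move=> i ltin; rewrite ltn_eqF//; exact: psi0.
    + move=> k /andP[nk]; rewrite ltnS => kn.
      by have -> : k = n; [apply/eqP; rewrite eqn_leq kn|rewrite eqxx].
  have [cphi dthj phi0 phith] := tri _ jn.
  rewrite (ltn_eqF jn)/=; split => //.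
  + by move=> i ij; rewrite ltn_eqF ?(ltn_trans ij)//; exact: phi0.
  + move=> k /andP[jk]; rewrite ltnS leq_eqVlt => /predU1P[->|kn].
      by rewrite eqxx; exact: (phiy (Ordinal jn)).
    by rewrite ltn_eqF//; apply: phith; rewrite jk.
- by move=> u; split.
- move=> n u v uv [tri lim]; split; last by move=> k kn; rewrite -uv//; exact: lim.
  move=> j jn; have [cphi dthj phi0 phith] := tri _ jn.
  rewrite -uv//; split => //.
  + by move=> i ij; rewrite -uv ?phi0// (ltn_trans ij).
  + by move=> k /[dup] /phith + /andP[_ kn]; rewrite -uv.
Qed.

End triangular_sequence.

(** The coefficient estimate keeps x j at distance at least d / 4 from the span of
the other points. *)
Lemma triangular_biorthogonal {R : realType} {X : normedModType R} (d : R) eps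
    (x : nat -> X) phi theta (j : nat) : 0 < d ->
    (forall k, 0 <= eps k) -> (forall n, \sum_(0 <= k < n) eps k <= d / 4) ->
    (forall n, triangular d eps n x phi theta) ->
  exists psi : {linear X -> R^o}, [/\ contractive psi, 0 < psi (x j)
    & forall k, k != j -> psi (x k) = 0].
Proof.
move=> d0 eps0 sumeps tri.
pose F := [set f | exists n (c : nat -> R),
  c j = 0 /\ f = \sum_(0 <= k < n) c k *: x k].
have F0 : F 0.
  by exists 0%N, (fun=> 0); split => //; rewrite big_geq.
have FL (a : R) f g : F f -> F g -> F (a *: f + g).
  move=> [m [b [bj ->]]] [n [c [cj ->]]].
  exists (maxn m n), (fun k => a * (if (k < m)%N then b k else 0) +
                               (if (k < n)%N then c k else 0)).
  split; first by rewrite bj cj !if_same mulr0 addr0.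
  rewrite (lincomb_widen _ _ (leq_maxl m n)) (lincomb_widen _ _ (leq_maxr m n)).
  rewrite scaler_sumr -big_split/=; apply: eq_bigr => k _.
  by rewrite scalerDl scalerA.
have xF y f : [set x j] y -> F f -> d / 4 <= `|y - f|.
  move=> -> [n [c [cj ->]]].
  pose N := maxn n j.+1; have jN : (j < N)%N by rewrite /N leq_max ltnSn orbT.
  pose b k : R := (k == j)%:R - (if (k < n)%N then c k else 0).
  have -> : x j - \sum_(0 <= k < n) c k *: x k = \sum_(0 <= k < N) b k *: x k.
    rewrite (lincomb_widen _ _ (leq_maxl n j.+1)) -/N.
    under [RHS]eq_bigr do rewrite scalerBl.
    rewrite sumrB; congr (_ - _).
    rewrite big_mkord (bigD1 (Ordinal jN))//= eqxx scale1r big1 ?addr0// => k kj.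
    by rewrite -[(k == j :> nat)]/(k == Ordinal jN) (negbTE kj) scale0r.
  have := triangular_coef_bound b d0 eps0 (sumeps N) (tri N) jN.
  by rewrite /b eqxx cj if_same subr0 normr1; lra.
have [|||psi [cpsi psiF psix]] :=
  @separation _ X [set x j] F (d / 4) _ _ _ F0 FL xF.
- by rewrite divr_ge0// ltW.
- by move=> _ _ t -> -> _ /=; rewrite -scalerDl addrC subrK scale1r.
- by exists (x j).
exists psi; split => //.
- by apply: lt_le_trans (psix _ erefl); rewrite divr_gt0.
- move=> k kj; apply: psiF; exists k.+1, (fun i => (i == k)%:R); split.
    by rewrite eq_sym (negbTE kj).
  rewrite big_mkord big_ord_recr/= eqxx scale1r big1 ?add0r// => i _.
  by rewrite ltn_eqF// scale0r.
Qed.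

(** * A fixed-point-free map close to the identity *)

Section closed_convex_hull.
Context {R : realType} {X : normedModType R}.

Definition closed_convex_hull (A : set X) : set X := [set z | forall S : set X,
  closed S -> segment_closed S -> A `<=` S -> S z].

Lemma sub_closed_convex_hull A : A `<=` closed_convex_hull A.
Proof. by move=> a Aa S _ _ /(_ _ Aa). Qed.

Lemma closed_convex_hull_closed A : closed (closed_convex_hull A).
Proof.
move=> p clp S clS cS AS; apply: (clS) => B /clp[y [Ky By]].
by exists y; split; [exact: Ky|].
Qed.

Lemma closed_convex_hull_convex A : segment_closed (closed_convex_hull A).
Proof.
move=> x y t Kx Ky t01 S clS cS AS.
by apply: (cS) => //; [exact: Kx|exact: Ky].
Qed.

End closed_convex_hull.

Section fixed_point_free_map.
Context {R : realType} {X : completeNormedModType R}.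
Variables (x : nat -> X) (phi psi : nat -> {linear X -> R^o}) (M d : R).
Hypotheses (M_gt0 : 0 < M) (d_gt0 : 0 < d).
Hypothesis xM : forall k, `|x k| <= M.
Hypothesis cphi : forall n, contractive (phi n).
Hypothesis phi0 : forall n k, (k < n)%N -> phi n (x k) = 0.
Hypothesis phid : forall n k, (n <= k)%N -> d <= phi n (x k).
Hypothesis cpsi : forall n, contractive (psi n).
Hypothesis psi_gt0 : forall n, 0 < psi n (x n).
Hypothesis psi0 : forall n k, k != n -> psi n (x k) = 0.

Let K := closed_convex_hull (range x).

(** The factor 1 / (4 M) bounds the norm of [drift] by 1/2, because the vectors
x k.+1 - x k have norm at most 2 M and the numbers 1 / 2 ^+ k.+1 add up to 1. *)
Definition drift_rate k : R := (4 * M)^-1 / 2 ^+ k.+1.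

Definition drift_term y k := (drift_rate k * psi k y) *: (x k.+1 - x k).

Definition drift y := limn (series (drift_term y)).

Lemma drift_rate_gt0 k : 0 < drift_rate k.
Proof. by rewrite divr_gt0 ?exprn_gt0// invr_gt0 mulr_gt0. Qed.

Lemma drift_term_le y k : `|drift_term y k| <= geometric_error (2 * `|y|) k.
Proof.
rewrite normrZ normrM gtr0_norm ?drift_rate_gt0//.
have xx : `|x k.+1 - x k| <= 2 * M.
  by apply: le_trans (ler_normB _ _) _; have := xM k; have := xM k.+1; lra.
have -> : geometric_error (2 * `|y|) k = drift_rate k * `|y| * (2 * M).
  rewrite /geometric_error /drift_rate; field.
  by rewrite expf_neq0 ?pnatr_eq0// gt_eqF.
apply: ler_pM => //; first by rewrite mulr_ge0// ltW// drift_rate_gt0.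
by rewrite ler_wpM2l ?cpsi// ltW// drift_rate_gt0.
Qed.

Lemma drift_normed_series_le y n : [normed series (drift_term y)] n <= `|y| / 2.
Proof.
apply: (@le_trans _ _ (\sum_(0 <= k < n) geometric_error (2 * `|y|) k)).
  by apply: ler_sum => k _; exact: drift_term_le.
by apply: le_trans (sum_geometric_error _ _) _; [rewrite mulr_ge0|lra].
Qed.

Lemma drift_normed_series_cvg y : cvgn [normed series (drift_term y)].
Proof.
apply: nondecreasing_is_cvgn.
  by apply: nondecreasing_series => n _ _; exact: normr_ge0.
by exists (`|y| / 2) => _ [n _ <-]; exact: drift_normed_series_le.
Qed.

Lemma drift_series_cvg y : series (drift_term y) @ \oo --> drift y.
Proof. exact: (normed_cvg (@drift_normed_series_cvg y)). Qed.

Lemma drift_le y : `|drift y| <= `|y| / 2.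
Proof.
apply: le_trans (lim_series_norm (@drift_normed_series_cvg y)) _.
apply: limr_le; first exact: drift_normed_series_cvg.
by apply: nearW => n; exact: drift_normed_series_le.
Qed.

Lemma drift_linear t y s z : drift (t *: y + s *: z) = t *: drift y + s *: drift z.
Proof.
apply: cvg_lim => //.
have -> : series (drift_term (t *: y + s *: z)) =
    (fun n => t *: series (drift_term y) n + s *: series (drift_term z) n).
  apply/funext => n; rewrite /series/= !scaler_sumr -big_split/=.
  apply: eq_bigr => k _; rewrite /drift_term !scalerA -scalerDl; congr (_ *: _).
  rewrite linearD !linearZ mulrDr; congr (_ + _); exact: mulrCA.
by apply: cvgD; apply: cvgZ; (exact: cvg_cst || exact: drift_series_cvg).
Qed.

Lemma driftB y z : drift (y - z) = drift y - drift z.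
Proof. by have := drift_linear 1 y (-1) z; rewrite !scale1r !scaleN1r. Qed.

Lemma drift_generator k :
  drift (x k) = (drift_rate k * psi k (x k)) *: (x k.+1 - x k).
Proof.
apply: cvg_lim => //; apply: cvg_near_cst; near=> n.
have kn : (k < n)%N by near: n; exact: nbhs_infty_gt.
rewrite /series/= big_mkord (bigD1 (Ordinal kn))//= big1 ?addr0// => i ik.
by rewrite /drift_term psi0 ?mulr0 ?scale0r// eq_sym.
Unshelve. all: by end_near. Qed.

(** By induction on n: when psi_i z = 0 for i < n, the functional psi_n sees only
the term of index n of the series, where it takes the value
- drift_rate n * psi_n z * psi_n (x_n). *)
Lemma drift_eq0 z : drift z = 0 -> forall n, psi n z = 0.
Proof.
move=> z0; elim/ltn_ind => n IH.
have psin N : (n < N)%N -> psi n (series (drift_term z) N) =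
    - (drift_rate n * psi n z * psi n (x n)).
  move=> nN; rewrite /series/= linear_sum big_mkord (bigD1 (Ordinal nN))//= big1.
    have psin1 : psi n (x n.+1) = 0 by rewrite psi0// gtn_eqF.
    rewrite addr0 /drift_term linearZ raddfB/= psin1 sub0r.
    by rewrite /GRing.scale/= mulrN.
  move=> i /= ni; have [ltin|] := ltnP i n.
    by rewrite /drift_term IH// mulr0 scale0r linear0.
  rewrite leq_eqVlt => /predU1P[nEi|ltni].
    by case/eqP: ni; apply: val_inj.
  rewrite /drift_term linearZ raddfB/= !psi0 ?gtn_eqF ?subrr ?scaler0//.
  exact: leqW.
have /cvgrPdist_lt lim0 : series (drift_term z) @ \oo --> (0 : X).
  by rewrite -z0; exact: drift_series_cvg.
have : drift_rate n * psi n z * psi n (x n) = 0.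
  apply/eqP; rewrite -normr_le0; apply/ler_addgt0Pr => e e0; rewrite add0r.
  near \oo => N.
  have nN : (n < N)%N by near: N; exact: nbhs_infty_gt.
  rewrite -normrN -(psin N)//; apply: le_trans (cpsi _ _) _.
  by rewrite -[series _ _]opprK normrN -sub0r ltW//; near: N; exact: lim0.
move/eqP; rewrite mulf_eq0 (gt_eqF (psi_gt0 n)) orbF mulf_eq0.
by rewrite (gt_eqF (drift_rate_gt0 n)) => /eqP.
Unshelve. all: by end_near. Qed.

Definition drift_map y := y + drift y.

Lemma drift_map_dist y z : `|y - z| / 2 <= `|drift_map y - drift_map z|
  /\ `|drift_map y - drift_map z| <= 3 / 2 * `|y - z|.
Proof.
rewrite /drift_map opprD addrACA -driftB.
have h := drift_le (y - z); split.
  have := lerB_normD (y - z) (drift (y - z)); lra.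
by apply: le_trans (ler_normD _ _) _; lra.
Qed.

Lemma drift_map_linear t y s z :
  drift_map (t *: y + s *: z) = t *: drift_map y + s *: drift_map z.
Proof. by rewrite /drift_map drift_linear addrACA -!scalerDr. Qed.

Lemma drift_map_continuous : continuous drift_map.
Proof.
move=> y; apply/cvgrPdist_lt => e e0; near=> z.
have [_ /le_lt_trans->//] := drift_map_dist y z.
suff : `|y - z| < e / 2 by lra.
by near: z; apply: cvgr_dist_lt; rewrite ?divr_gt0.
Unshelve. all: by end_near. Qed.

(** The preimage of a closed convex set under a continuous affine map is closed and
convex, so it is enough to look at the points x k; each is moved to a convex
combination of x k and x k.+1. *)
Lemma drift_map_hull y : K y -> K (drift_map y).
Proof.
move=> Ky S clS cS xS.
apply: (Ky (drift_map @^-1` S)).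
- by apply: preimage_closed => // z _; exact: drift_map_continuous.
- by move=> u v t Su Sv t01; rewrite /preimage/= drift_map_linear; exact: cS.
- move=> _ [k _ <-] /=; rewrite /drift_map drift_generator.
  set b := drift_rate k * _.
  have b0 : 0 <= b by rewrite mulr_ge0// ltW// drift_rate_gt0.
  have b1 : b <= 1.
    have psiM : psi k (x k) <= M.
      by apply: le_trans (ler_norm _) _; exact: le_trans (cpsi k _) (xM k).
    apply: (@le_trans _ _ (drift_rate k * M)).
      by rewrite ler_wpM2l// ltW// drift_rate_gt0.
    have -> : drift_rate k * M = 4^-1 * (2 ^+ k.+1)^-1.
      by rewrite /drift_rate; field; rewrite expf_neq0 ?pnatr_eq0// gt_eqF.
    have : (2 ^+ k.+1)^-1 <= 1 :> R.
      by rewrite invf_le1 ?exprn_gt0 ?exprn_ege1 ?ler1n.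
    by move: (2 ^+ k.+1)^-1 => z; lra.
  have -> : x k + b *: (x k.+1 - x k) = b *: x k.+1 + (1 - b) *: x k.
    by rewrite scalerBr scalerBl scale1r addrCA.
  by apply: cS; rewrite ?b0//; apply: xS; [exists k.+1|exists k].
Qed.

(** The phi_n are equicontinuous, so the points where they tend to 0 form a closed
subspace; it contains each x k, on which phi_n vanishes for n > k. *)
Lemma hull_functional_cvg0 z : K z -> phi^~ z @ \oo --> (0 : R^o).
Proof.
move=> /(_ [set z | phi^~ z @ \oo --> (0 : R^o)]); apply.
- move=> p clp; apply/cvgrPdist_lt => e e0.
  have e2 : 0 < e / 2 by rewrite divr_gt0.
  have [y [/cvgrPdist_lt/(_ _ e2) yn]] := clp _ (nbhsx_ballx p _ e2).
  rewrite -ball_normE /= => py; near=> n.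
  have : `|0 - phi n y| < e / 2 by near: n; exact: yn.
  have := cphi n (p - y); rewrite raddfB !sub0r !normrN => h1 h2.
  have -> : phi n p = (phi n p - phi n y) + phi n y by rewrite subrK.
  by apply: le_lt_trans (ler_normD _ _) _; lra.
- move=> u v t un vn _.
  have : (fun n => t * phi n u + (1 - t) * phi n v) @ \oo -->
      (t * 0 + (1 - t) * 0 : R^o).
    by apply: cvgD; apply: cvgM => //; exact: cvg_cst.
  rewrite !mulr0 addr0 /=.
  by under [X in _ -> X]eq_cvg do rewrite linearD !linearZ.
- move=> _ [k _ <-]; apply: cvg_near_cst; near=> n.
  by apply: phi0; near: n; exact: nbhs_infty_gt.
Unshelve. all: by end_near. Qed.

(** On a convex combination of the x_k, psi_i z / psi_i (x_i) is the mass at x_i,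
and phi_n is at least d times the mass carried by the indices k >= n. The
inequality is affine and continuous in z, so it is checked at the x_k only. *)
Lemma hull_functional_ge n z : K z ->
  d <= phi n z + d * \sum_(i < n) psi i z / psi i (x i).
Proof.
pose g y := phi n y + d * \sum_(i < n) psi i y / psi i (x i).
move=> /(_ [set y | d <= g y]); rewrite /g; apply.
- apply: (@closed_comp _ _ g
    [set r | d <= r]); last exact: closed_ge.
  move=> y _; apply: cvgD; first exact: contractive_continuous.
  apply: cvgM; first exact: cvg_cst.
  apply: cvg_big => [|i _]; first exact: add_continuous.
  by apply: cvgM; [exact: contractive_continuous|exact: cvg_cst].
- move=> u v t /= du dv /andP[t0 t1].
  rewrite linearD !linearZ/=.
  have -> : \sum_(i < n) psi i (t *: u + (1 - t) *: v) / psi i (x i) =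
      t * \sum_(i < n) psi i u / psi i (x i)
      + (1 - t) * \sum_(i < n) psi i v / psi i (x i).
    rewrite !mulr_sumr -big_split/=; apply: eq_bigr => i _.
    by rewrite linearD !linearZ/= mulrDl !mulrA.
  have := ler_wpM2l t0 du.
  have t1' : 0 <= 1 - t by rewrite subr_ge0.
  have := ler_wpM2l t1' dv.
  by rewrite /GRing.scale/=; lra.
- move=> _ [k _ <-] /=; have [nk|kn] := leqP n k.
    rewrite big1 ?mulr0 ?addr0; first exact: phid.
    by move=> i _; rewrite psi0 ?mul0r// gtn_eqF// (leq_trans _ nk).
  rewrite phi0// add0r (bigD1 (Ordinal kn))//= divff ?gt_eqF// big1 ?addr0 ?mulr1//.
  move=> i ik; rewrite psi0 ?mul0r//; apply: contraNneq ik => ki.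
  exact/eqP/val_inj.
Qed.

Lemma drift_map_no_fixed_point z : K z -> drift_map z <> z.
Proof.
move=> Kz /eqP; rewrite -subr_eq0 addrAC subrr add0r => /eqP/drift_eq0 psiz.
have /cvgrPdist_lt/(_ d d_gt0) phiz := hull_functional_cvg0 Kz.
near \oo => n.
have : `|0 - phi n z| < d by near: n; exact: phiz.
have := hull_functional_ge n Kz.
rewrite big1 ?mulr0 ?addr0 => [|i _]; last by rewrite psiz mul0r.
by rewrite sub0r normrN => dphi /(le_lt_trans (ler_norm _)); rewrite ltNge dphi.
Unshelve. all: by end_near. Qed.

End fixed_point_free_map.

(** * The characterization of weak compactness *)

Section weak_compactness_criterion.
Context {R : realType} {X : completeNormedModType R}.
Variables (C : set X) (M : R).
Hypotheses (clC : closed C) (cC : segment_closed C) (M_gt0 : 0 < M).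
Hypothesis CM : forall x, C x -> `|x| <= M.

(** The errors eps k are at most d / 4 and the constants theta n at least d, so the
rows of the triangular system are at least d / 2 from the diagonal on. *)
Lemma not_weakly_compact_sequence : ~ weakly_compact C ->
  exists (x : nat -> X) (phi psi : nat -> {linear X -> R^o}) (d : R),
  [/\ 0 < d, forall k, C (x k),
      forall n, [/\ contractive (phi n), forall k, (k < n)%N -> phi n (x k) = 0
        & forall k, (n <= k)%N -> d <= phi n (x k)]
    & forall n, [/\ contractive (psi n), 0 < psi n (x n)
        & forall k, k != n -> psi n (x k) = 0]].
Proof.
move=> nwC; have [U [ultraU UC nlim]] : exists U : set_system X,
    [/\ UltraFilter U, U C & forall p, ~ forall phi : {linear X -> R^o},
      contractive phi -> phi @ U --> phi p].
  apply: contrapT => noU; apply: nwC; rewrite /weakly_compact compact_ultra.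
  move=> U ultraU UC; have PU : ProperFilter U by exact: ultra_proper.
  apply: contrapT => nlim; apply: noU; exists U; split => // p plim.
  have Up : U --> (p : weak_topology X) by exact: weak_cvgP.
  apply: nlim; exists p; split => //.
  apply: (weak_cluster_closed_convex PU clC cC UC).
  by rewrite (@ultra_cvg_clusterE (weak_topology X)).
have PU : ProperFilter U by exact: ultra_proper.
have fcvg phi : contractive phi -> exists theta : R, phi @ U --> (theta : R^o).
  exact: (ultrafilter_functional_cvg ultraU UC CM).
have [d0 d0_gt0 gap] := uniform_gap ultraU UC CM nlim.
pose d := d0 / 2.
have d_gt0 : 0 < d by rewrite divr_gt0.
have dd0 : d < d0 by rewrite /d; lra.
have [x [phi [theta [Cx tri]]]] :=
  triangular_sequence PU UC cC CM fcvg d_gt0 dd0 gap.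
have eps0 k : 0 <= geometric_error d k.
  by rewrite /geometric_error !divr_ge0// ?exprn_ge0// ltW.
have sumeps n := sum_geometric_error n (ltW d_gt0).
have /choice[psi psiP] : forall n, exists psi : {linear X -> R^o},
    [/\ contractive psi, 0 < psi (x n) & forall k, k != n -> psi (x k) = 0].
  by move=> n; exact: (triangular_biorthogonal n d_gt0 eps0 sumeps tri).
exists x, phi, psi, (d / 2); split => //; first by rewrite divr_gt0.
move=> n; have [cphi dth phi0 _] := tri _ n (ltnSn n); split => // k nk.
have [_ _ _ /(_ k)] := tri k.+1 n nk; rewrite nk ltnSn => /(_ isT).
have : geometric_error d k <= d / 4.
  rewrite /geometric_error ler_pdivrMr ?exprn_gt0//.
  rewrite ler_peMr ?divr_ge0 ?exprn_ege1 ?ler1n//.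
  exact: ltW.
by rewrite ler_norml => epsd /andP[? _]; lra.
Qed.

(** The bi-Lipschitz constant of the drift map is (1 / 2)^-1 * (3 / 2) = 3. *)
Lemma GFPP_weakly_compact :
  GFPP C (bilipschitz_affine 3) -> weakly_compact C.
Proof.
move=> fppC; apply: contrapT => /not_weakly_compact_sequence.
move=> [x [phi [psi [d [d_gt0 Cx phiP psiP]]]]].
have cphi n : contractive (phi n) by have [] := phiP n.
have phi0 n k : (k < n)%N -> phi n (x k) = 0 by have [_ + _] := phiP n; exact.
have phid n k : (n <= k)%N -> d <= phi n (x k) by have [_ _] := phiP n; exact.
have cpsi n : contractive (psi n) by have [] := psiP n.
have psi_gt0 n : 0 < psi n (x n) by have [] := psiP n.
have psi0 n k : k != n -> psi n (x k) = 0 by have [_ _] := psiP n; exact.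
have xM k : `|x k| <= M by exact: CM.
pose K := closed_convex_hull (range x); pose f := drift_map x psi M.
have KC : K `<=` C.
  by move=> z; apply => // _ [k _ <-].
have fdist y z := drift_map_dist M_gt0 xM cpsi y z.
have [|||z Kz] := fppC K f.
- split => //.
  + by exists (x 0%N); apply: sub_closed_convex_hull; exists 0%N.
  + exists M; split; first exact: num_real.
    by move=> N MN y /KC/CM yM; exact: le_trans yM (ltW MN).
  + exact: closed_convex_hull_closed.
  + by apply/convex_setE; exact: closed_convex_hull_convex.
- split.
    exists (2^-1), (3 / 2); split; [by []|by []|by rewrite invrK; lra|].
    by move=> y z _ _; have [h1 h2] := fdist y z; split => //; rewrite mulrC.
  by move=> y z t _ _ _; exact: (drift_map_linear M_gt0 xM cpsi).
- by move=> _ [y Ky <-]; exact: (drift_map_hull M_gt0 xM cpsi psi_gt0 psi0).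
- exact: (drift_map_no_fixed_point M_gt0 d_gt0 xM cphi phi0 phid cpsi psi_gt0 psi0).
Qed.

End weak_compactness_criterion.

Theorem theorem4p1 (R : realType) (X : completeNormedModType R) (C : set X)
    (hC : bcc setT C) :
  weakly_compact C <->
  (forall L : R, 1 < L -> GFPP C (bilipschitz_affine L)).
Proof.
split=> [wC L _ K f [KC K0 bK clK /convex_setE cK] [lipf aff] fK|fpp].
  have [c1 [c2 [_ _ _ lip]]] := lipf.
  have fK' x : K x -> K (f x) by move=> Kx; apply: fK; exists x.
  apply: (weakly_compact_fixed_point cK fK' aff wC KC K0 bK clK (c := c2)).
  by move=> x y Kx Ky; have [] := lip x y Kx Ky.
have [_ _ [M [_ MC]] clC /convex_setE cC] := hC.
apply: (@GFPP_weakly_compact _ _ _ (`|M| + 1)) => //.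
- by move=> x Cx; apply: MC => //; rewrite (le_lt_trans (ler_norm M))// ltrDl.
- by apply: fpp; rewrite ltr1n.
Qed.
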